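(* Let $\Omega$ be a Hausdorff compact topological space and $X$ be a complex Banach space. Let $C(\Omega,X)$ be the space of continuous functions $f:\Omega\to X$ with the norm $\|f\|=\sup\{\|f(\omega)\|_X:\omega\in\Omega\}$, equipped with the $C(\Omega)$-module structure given by pointwise multiplication. Then the Banach $C(\Omega)$-module $C(\Omega,X)$ is nice.
   Context: All vector spaces are over $\mathbb{C}$; $C(\Omega)$ is the Banach algebra of continuous complex-valued functions on $\Omega$ with the supremum norm. Let $\mathbb{A}$ be a unital commutative semisimple Banach algebra and $M$ a Banach $\mathbb{A}$-module. A submodule of $M$ is a linear subspace invariant under the action of $\mathbb{A}$. The module $M$ is called nice if every proper closed submodule of $M$ is contained in a closed submodule of $M$ of codimension $1$. Equivalently, for every proper closed submodule $N$ of $M$ there is a character on $M$ vanishing on $N$, where a character on $M$ is a non-zero continuous linear functional $\phi:M\to\mathbb{C}$ for which there is a (possibly identically zero) algebra homomorphism $\varkappa:\mathbb{A}\to\mathbb{C}$ with $\phi(am)=\varkappa(a)\phi(m)$ for all $a\in\mathbb{A}$, $m\in M$. *)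

(* Defs.v *)
From HB Require Import structures.
From mathcomp Require Import all_boot all_order all_algebra complex.
From mathcomp Require Import all_classical all_reals all_analysis.
From mathcomp Require Import ring lra.

Set Implicit Arguments.
Unset Strict Implicit.
Unset Printing Implicit Defensive.

Import Order.TTheory GRing.Theory Num.Theory.
Import numFieldNormedType.Exports.
Import mathcomp.real_closed.complex.

Local Open Scope classical_set_scope.
Local Open Scope ring_scope.

(* The ring operations are fields of the record: joining a mathcomp ring
   structure with a normed module structure is not possible in an HB hierarchy
   that already contains Num.NumDomain. The zero algebra is allowed (it is
   C(Omega) for empty Omega). *)
Record comBanachAlgebra (K : numFieldType) := ComBanachAlgebra {
  balg_sort :> completeNormedModType K;
  balg_one : balg_sort;
  balg_mul : balg_sort -> balg_sort -> balg_sort;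
  balg_mulA : associative balg_mul;
  balg_mulC : commutative balg_mul;
  balg_mul1 : left_id balg_one balg_mul;
  balg_mulDl : left_distributive balg_mul +%R;
  balg_scaleAl : forall (k : K) a b,
    k *: balg_mul a b = balg_mul (k *: a) b;
  balg_ler_normM : forall a b, `|balg_mul a b| <= `|a| * `|b|
}.

Section semisimple.
Variables (K : numFieldType) (A : comBanachAlgebra K).
Implicit Types I J : set A.

Definition ideal I :=
  [/\ I 0, forall a b, I a -> I b -> I (a + b)
    & forall a b, I b -> I (balg_mul a b)].

Definition maximal_ideal I :=
  [/\ ideal I, ~ I (balg_one A)
    & forall J, ideal J -> ~ J (balg_one A) -> I `<=` J -> J = I].

(* the Jacobson radical is zero *)
Definition semisimple := forall a : A,
  (forall I, maximal_ideal I -> I a) -> a = 0.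

End semisimple.

Record ssComBanachAlgebra (K : numFieldType) := SsComBanachAlgebra {
  ssalg :> comBanachAlgebra K;
  ssalg_semisimple : semisimple ssalg
}.

(* The action is not required to be unital. *)
Record banachModule (K : numFieldType) (A : ssComBanachAlgebra K) :=
  BanachModule {
    bmod_sort :> completeNormedModType K;
    bmod_act : A -> bmod_sort -> bmod_sort;
    bmod_actDl : forall a b m,
      bmod_act (a + b) m = bmod_act a m + bmod_act b m;
    bmod_actDr : forall a m n,
      bmod_act a (m + n) = bmod_act a m + bmod_act a n;
    bmod_actZl : forall (k : K) a m, bmod_act (k *: a) m = k *: bmod_act a m;
    bmod_actZr : forall (k : K) a m, bmod_act a (k *: m) = k *: bmod_act a m;
    bmod_actA : forall a b m, bmod_act (balg_mul a b) m = bmod_act a (bmod_act b m);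
    bmod_ler_norm : forall a m, `|bmod_act a m| <= `|a| * `|m|
  }.

Section nice.
Variables (K : numFieldType) (A : ssComBanachAlgebra K) (M : banachModule A).
Implicit Types N L : set M.

Definition submodule N :=
  [/\ N 0, forall m n, N m -> N n -> N (m + n),
      forall (k : K) m, N m -> N (k *: m)
    & forall (a : A) m, N m -> N (bmod_act a m)].

(* for a linear subspace N: dim (M / N) = 1, i.e. M / N is spanned by the
   class of some v that is nonzero in M / N *)
Definition codim1 N :=
  exists2 v : M, ~ N v & forall m : M, exists k : K, N (m - k *: v).

Definition nice := forall N, submodule N -> closed N -> N != setT ->
  exists L, [/\ submodule L, closed L, codim1 L & N `<=` L].

End nice.

HB.instance Definition _ (R : realType) := NormedModule.copy R[i] R[i]^o.

Section complex_facts.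
Variable R : realType.

Lemma normc_reE (V : normedModType R[i]) (x : V) : (Re `|x|)%:C%C = `|x|.
Proof. by rewrite RRe_real ?normr_real. Qed.

Lemma lecR_Re (x y : R[i]) : x <= y -> Re x <= Re y.
Proof. by rewrite lecE => /andP[]. Qed.

Lemma normc_ge_Im (x : R[i]) : `|Im x|%:C%C <= `|x|.
Proof.
have := normc_ge_Re (x * 'i%C); rewrite ReiNIm normrN normrM.
suff -> : `|'i%C : R[i]| = 1 by rewrite mulr1.
by rewrite normc_def /= expr0n /= expr1n add0r sqrtr1.
Qed.

Lemma normc_le_ReIm (x : R[i]) : `|x| <= (`|Re x| + `|Im x|)%:C%C.
Proof.
rewrite {1}(complexE x) (le_trans (ler_normD _ _))// normrM.
have -> : `|'i%C : R[i]| = 1 by rewrite normc_def /= expr0n /= expr1n add0r sqrtr1.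
by rewrite mul1r !normc_def /= !expr0n /= !addr0 !sqrtr_sqr rmorphD.
Qed.

Lemma complex_complete (F : set_system R[i]) :
  ProperFilter F -> cauchy F -> cvg F.
Proof.
move=> FF /cauchyP Fc.
have part (g : R[i] -> R) : (forall x y, g (x - y) = g x - g y) ->
    (forall x, `|g x|%:C%C <= `|x|) -> cvg (g @ F).
  move=> gB gle; apply: R_complete; apply: cauchy_exP => e e0.
  have [x Fx] := Fc e%:C%C (eqbRL (ltcR _ _) e0).
  exists (g x); change (F [set y | ball (g x) e (g y)]).
  apply: filterS Fx => y; rewrite -!ball_normE /= => xy.
  by have := le_lt_trans (gle (x - y)) xy; rewrite gB ltcR.
have cRe : cvg (@Re R @ F).
  by apply: part => [[a b] [c d]//|x]; exact: normc_ge_Re.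
have cIm : cvg (@Im R @ F).
  by apply: part => [[a b] [c d]//|x]; exact: normc_ge_Im.
apply/cvg_ex; exists (Complex (lim (@Re R @ F)) (lim (@Im R @ F))).
apply/fcvg_ballP => e e0.
have eE : e = (Re e)%:C%C by rewrite RRe_real ?gtr0_real.
have e0' : 0 < Re e / 2 by rewrite divr_gt0// -ltcR -eE.
move/cvgrPdist_lt : cRe => /(_ _ e0') H1.
move/cvgrPdist_lt : cIm => /(_ _ e0') H2.
apply: filterS2 H1 H2 => -[a b] /=; rewrite -ball_normE /= => H1 H2.
apply: le_lt_trans (normc_le_ReIm _) _ => /=.
by rewrite eE ltcR (splitr (Re e)) ltrD.
Qed.

End complex_facts.

HB.instance Definition _ (R : realType) :=
  Uniform_isComplete.Build R[i] (@complex_complete R).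

(* C(Omega, X); the compactness of Omega is a parameter of the type since the
   supremum norm needs it *)
Definition contfun (R : realType) (Omega : topologicalType)
    (cOmega : compact [set: Omega]) (X : completeNormedModType R[i]) :=
  continuousType Omega X.

Section contfun_module.
Context {R : realType} {Omega : topologicalType}
  (cOmega : compact [set: Omega]) (X : completeNormedModType R[i]).
Local Notation CX := (contfun cOmega X).
Implicit Types f g h : CX.

HB.instance Definition _ := Choice.copy CX (continuousType Omega X).

Lemma contfunP f g : (forall w, f w = g w) -> f = g.
Proof. by move=> fg; apply/continuousEP. Qed.

Lemma contfun_cst_continuous (x : X) : continuous (fun _ : Omega => x).
Proof. by move=> w; exact: cvg_cst. Qed.
Lemma contfun_opp_continuous f : continuous (fun w => - f w).
Proof. by move=> w; apply: cvgN; exact: cts_fun. Qed.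
Lemma contfun_add_continuous f g : continuous (fun w => f w + g w).
Proof. by move=> w; apply: cvgD; exact: cts_fun. Qed.
Lemma contfun_scale_continuous (k : R[i]) f : continuous (fun w => k *: f w).
Proof. by move=> w; apply: cvgZr; exact: cts_fun. Qed.

Definition contfun_cst (x : X) : CX := mkcts (@contfun_cst_continuous x).
Definition contfun_opp f : CX := mkcts (@contfun_opp_continuous f).
Definition contfun_add f g : CX := mkcts (@contfun_add_continuous f g).
Definition contfun_scale (k : R[i]) f : CX :=
  mkcts (@contfun_scale_continuous k f).

Lemma contfun_addA : associative contfun_add.
Proof. by move=> f g h; apply: contfunP => w /=; exact: addrA. Qed.
Lemma contfun_addC : commutative contfun_add.
Proof. by move=> f g; apply: contfunP => w /=; exact: addrC. Qed.
Lemma contfun_add0 : left_id (contfun_cst 0) contfun_add.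
Proof. by move=> f; apply: contfunP => w /=; exact: add0r. Qed.
Lemma contfun_addN : left_inverse (contfun_cst 0) contfun_opp contfun_add.
Proof. by move=> f; apply: contfunP => w /=; exact: addNr. Qed.

HB.instance Definition _ := GRing.isZmodule.Build CX
  contfun_addA contfun_addC contfun_add0 contfun_addN.

Lemma contfun_scaleA k l f :
  contfun_scale k (contfun_scale l f) = contfun_scale (k * l) f.
Proof. by apply: contfunP => w /=; exact: scalerA. Qed.
Lemma contfun_scale1 : left_id 1 contfun_scale.
Proof. by move=> f; apply: contfunP => w /=; exact: scale1r. Qed.
Lemma contfun_scaleDr : right_distributive contfun_scale +%R.
Proof. by move=> k f g; apply: contfunP => w /=; exact: scalerDr. Qed.
Lemma contfun_scaleDl f : {morph contfun_scale^~ f : k l / k + l}.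
Proof. by move=> k l; apply: contfunP => w /=; exact: scalerDl. Qed.

HB.instance Definition _ := GRing.Zmodule_isLmodule.Build R[i] CX
  contfun_scaleA contfun_scale1 contfun_scaleDr contfun_scaleDl.

(* Norms of R[i]-modules take their values in R[i], where they are real. For
   empty Omega, sup set0 = 0. *)
Definition supnorm f : R[i] := (sup [set Re `|f w| | w in [set: Omega]])%:C%C.

Lemma contfun_ubound f : has_ubound [set Re `|f w| | w in [set: Omega]].
Proof.
have cnt : continuous (fun w => Re `|f w| : R).
  move=> w; apply/cvgrPdist_lt => e e0.
  have /cvgrPdist_lt /(_ e%:C%C) := cts_fun (s := f) w.
  move=> /(_ (eqbRL (ltcR _ _) e0)); apply: filterS => v fwv.
  rewrite -ltcR; apply: le_lt_trans fwv.
  have -> : Re `|f w| - Re `|f v| = Re (`|f w| - `|f v|).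
    by case: `|f w| => ? ?; case: `|f v|.
  by apply: le_trans (normc_ge_Re _) _; exact: ler_dist_dist.
have [M [Mr MP]] := compact_bounded
  (continuous_compact (continuous_subspaceT cnt) cOmega).
exists (M + 1) => x fx; apply: le_trans (ler_norm x) _.
by apply: (MP (M + 1)); rewrite ?ltrDl.
Qed.

Lemma supnorm_ge f w : `|f w| <= supnorm f.
Proof.
rewrite -normc_reE lecR; apply: (ub_le_sup (contfun_ubound f)).
by exists w.
Qed.

Lemma supnorm_le f (M : R[i]) :
  0 <= M -> (forall w, `|f w| <= M) -> supnorm f <= M.
Proof.
move=> M0 fM; have ME : M = (Re M)%:C%C by rewrite RRe_real ?ger0_real.
rewrite ME lecR.
have [->|/set0P ne] := eqVneq [set Re `|f w| | w in [set: Omega]] set0.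
  by rewrite sup0 -lecR -ME.
by apply: ge_sup => // _ [w _ <-]; exact: lecR_Re.
Qed.

Lemma supnorm_ge0 f : 0 <= supnorm f.
Proof.
rewrite -(rmorph0 (real_complex R)) lecR.
have [->|/set0P[x fx]] := eqVneq [set Re `|f w| | w in [set: Omega]] set0.
  by rewrite sup0.
apply: le_trans (ub_le_sup (contfun_ubound f) fx).
by case: fx => w _ <-; rewrite (lecR_Re (normr_ge0 (f w))).
Qed.

Lemma supnormD f g : supnorm (f + g) <= supnorm f + supnorm g.
Proof.
apply: supnorm_le => [|w]; first by rewrite addr_ge0 ?supnorm_ge0.
by rewrite (le_trans (ler_normD _ _))// lerD ?supnorm_ge.
Qed.

Lemma supnormZ_le (k : R[i]) f : supnorm (k *: f) <= `|k| * supnorm f.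
Proof.
apply: supnorm_le => [|w]; first by rewrite mulr_ge0 ?supnorm_ge0.
by rewrite [leLHS]normrZ ler_wpM2l ?supnorm_ge.
Qed.

Lemma supnormZ (k : R[i]) f : supnorm (k *: f) = `|k| * supnorm f.
Proof.
apply/eqP; rewrite eq_le supnormZ_le /=.
have [->|k0] := eqVneq k 0; first by rewrite normr0 mul0r supnorm_ge0.
rewrite -ler_pdivlMl ?normr_gt0// -normfV.
by rewrite -{1}[f](scalerK k0) supnormZ_le.
Qed.

Lemma supnorm0_eq0 f : supnorm f = 0 -> f = 0.
Proof.
move=> f0; apply: contfunP => w; apply/eqP.
by rewrite -normr_le0 -f0 supnorm_ge.
Qed.

HB.instance Definition _ := Lmodule_isNormed.Build R[i] CX
  supnormD supnormZ supnorm0_eq0.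

Lemma contfun_normE f : `|f| = supnorm f. Proof. by []. Qed.

Lemma contfun_complete (F : set_system CX) :
  ProperFilter F -> cauchy F -> cvg F.
Proof.
move=> FF /cauchyP Fc.
have dist f g w : `|f w - g w| <= `|f - g| by exact: (supnorm_ge (f - g)).
have cw w : cvg ((fun f : CX => f w) @ F).
  apply: cauchy_cvg; apply: cauchy_exP => e e0.
  have [f Ff] := Fc e e0; exists (f w); change (F [set g : CX | ball (f w) e (g w)]).
  apply: filterS Ff => g; by rewrite -!ball_normE /= => /(le_lt_trans (dist f g w)).
pose l w := lim ((fun f : CX => f w) @ F).
have lE (e : R[i]) f : 0 < e -> F (ball f e) ->
    forall w, `|f w - l w| <= e + e.
  move=> e0 Ff w; have /cvgrPdist_lt /(_ e e0) lw := cw w.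
  have [g [fg gl]] := filter_ex (filterI Ff lw).
  rewrite /= -/(l w) in gl; rewrite -ball_normE /= in fg.
  rewrite -(subrKA (g w)) (le_trans (ler_normD _ _))// lerD//.
    exact: le_trans (dist f g w) (ltW fg).
  by rewrite distrC ltW.
have lc : continuous l.
  move=> w; apply/cvgrPdist_le => e e0.
  have e5 : 0 < e / 5%:R by rewrite divr_gt0.
  have [f Ff] := Fc _ e5.
  have /cvgrPdist_lt /(_ _ e5) := cts_fun (s := f) w.
  apply: filterS => v fv.
  have -> : e = (e / 5%:R + e / 5%:R) +
      (e / 5%:R + (e / 5%:R + e / 5%:R)) by field.
  rewrite -(subrKA (f w)) (le_trans (ler_normD _ _))// lerD//.
    by rewrite distrC lE.
  rewrite -(subrKA (f v)) (le_trans (ler_normD _ _))// lerD//.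
    exact: ltW.
  exact: lE.
apply/cvg_ex; exists (mkcts lc : CX); apply/fcvg_ballP => e e0.
have e4 : 0 < e / 4%:R by rewrite divr_gt0.
have [f Ff] := Fc _ e4; apply: filterS (Ff) => g.
rewrite -!ball_normE /= => fg.
have -> : e = (e / 4%:R + e / 4%:R) + (e / 4%:R + e / 4%:R) by field.
rewrite -(subrKA f) (le_lt_trans (ler_normD _ _))// ler_ltD//.
  rewrite contfun_normE; apply: supnorm_le => [|w].
    by rewrite addr_ge0 ?ltW.
  by rewrite [X in `|X|](_ : _ = l w - f w)// distrC lE.
by rewrite (lt_trans fg)// ltrDl.
Qed.

HB.instance Definition _ := Uniform_isComplete.Build CX contfun_complete.

End contfun_module.

Section contfun_algebra.
Context {R : realType} {Omega : topologicalType}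
  (cOmega : compact [set: Omega]).
Local Notation CC := (contfun cOmega R[i]).

Lemma contfun_act_continuous (X : completeNormedModType R[i])
  (a : CC) (f : contfun cOmega X) : continuous (fun w => a w *: f w).
Proof. by move=> w; apply: cvgZ; exact: cts_fun. Qed.

Definition contfun_act (X : completeNormedModType R[i])
    (a : CC) (f : contfun cOmega X) : contfun cOmega X :=
  mkcts (@contfun_act_continuous X a f).

Lemma contfun_act_norm (X : completeNormedModType R[i])
  (a : CC) (f : contfun cOmega X) : `|contfun_act a f| <= `|a| * `|f|.
Proof.
apply: supnorm_le => [|w]; first by rewrite mulr_ge0 ?normr_ge0.
by rewrite [leLHS]normrZ ler_pM ?normr_ge0 ?supnorm_ge.
Qed.

Lemma contfun_mul_continuous (a b : CC) : continuous (fun w => a w * b w).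
Proof. exact: contfun_act_continuous. Qed.

Definition contfun_mul (a b : CC) : CC := mkcts (@contfun_mul_continuous a b).

Lemma contfun_mulA : associative contfun_mul.
Proof. by move=> a b c; apply: contfunP => w /=; exact: mulrA. Qed.
Lemma contfun_mulC : commutative contfun_mul.
Proof. by move=> a b; apply: contfunP => w /=; exact: mulrC. Qed.
Lemma contfun_mul1 : left_id (contfun_cst cOmega (1 : R[i])) contfun_mul.
Proof. by move=> a; apply: contfunP => w /=; exact: mul1r. Qed.
Lemma contfun_mulDl : left_distributive contfun_mul +%R.
Proof. by move=> a b c; apply: contfunP => w /=; exact: mulrDl. Qed.

Lemma contfun_scaleAl (k : R[i]) (a b : CC) :
  k *: contfun_mul a b = contfun_mul (k *: a) b.
Proof. by apply: contfunP => w /=; exact: mulrA. Qed.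

Definition contfun_comBanachAlgebra : comBanachAlgebra R[i] :=
  ComBanachAlgebra contfun_mulA contfun_mulC contfun_mul1 contfun_mulDl
    contfun_scaleAl (@contfun_act_norm R[i]).

Lemma contfun_semisimple : semisimple contfun_comBanachAlgebra.
Proof.
move=> a aI; apply: contfunP => w.
suff : @maximal_ideal _ contfun_comBanachAlgebra [set b : CC | b w = 0].
  by move/aI.
split.
- split=> [//|b c /= b0 c0|b c /= c0].
    by rewrite -[LHS]/(b w + c w) b0 c0 addr0.
  by rewrite -[LHS]/(b w * c w) c0 mulr0.
- by move=> /eqP; rewrite -[X in X == _]/(1 : R[i]) oner_eq0.
move=> J [J0 JD JM] J1 IJ; apply/seteqP; split=> // b Jb /=.
apply: contrapT => /eqP bw; apply: J1.
pose c : CC := contfun_cst cOmega (b w)^-1.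
pose d : CC := contfun_mul c b.
have -> : balg_one contfun_comBanachAlgebra =
    (balg_one contfun_comBanachAlgebra : CC) - d + d by rewrite subrK.
apply: JD; last exact: JM Jb.
apply: IJ => /=.
by rewrite -[LHS]/(1 - (b w)^-1 * b w) mulVf ?subrr.
Qed.

Definition contfun_ssComBanachAlgebra : ssComBanachAlgebra R[i] :=
  SsComBanachAlgebra contfun_semisimple.

Variable X : completeNormedModType R[i].
Local Notation CX := (contfun cOmega X).

Lemma contfun_actDl (a b : CC) (f : CX) :
  contfun_act (a + b) f = contfun_act a f + contfun_act b f.
Proof. by apply: contfunP => w /=; exact: scalerDl. Qed.
Lemma contfun_actDr (a : CC) (f g : CX) :
  contfun_act a (f + g) = contfun_act a f + contfun_act a g.
Proof. by apply: contfunP => w /=; exact: scalerDr. Qed.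
Lemma contfun_actZl (k : R[i]) (a : CC) (f : CX) :
  contfun_act (k *: a) f = k *: contfun_act a f.
Proof. by apply: contfunP => w /=; symmetry; exact: scalerA. Qed.
Lemma contfun_actZr (k : R[i]) (a : CC) (f : CX) :
  contfun_act a (k *: f) = k *: contfun_act a f.
Proof.
by apply: contfunP => w /=; rewrite -[RHS]/(k *: (a w *: f w)) -[LHS]/(a w *: (k *: f w)) !scalerA mulrC.
Qed.
Lemma contfun_actA (a b : CC) (f : CX) :
  contfun_act (contfun_mul a b) f = contfun_act a (contfun_act b f).
Proof. by apply: contfunP => w /=; symmetry; exact: scalerA. Qed.

Definition contfun_banachModule : banachModule contfun_ssComBanachAlgebra :=
  @BanachModule R[i] contfun_ssComBanachAlgebra CX (@contfun_act X)
    contfun_actDl contfun_actDr contfun_actZl contfun_actZr contfun_actA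
    (@contfun_act_norm X).

End contfun_algebra.

(* Main.v *)
(* If a closed submodule N contains, near each point w, functions with values
   arbitrarily close to f0 w, then f0 lies in N: weighting finitely many of them
   by the bumps max(0, d - |f0 - g|) and dividing by the sum of the bumps, which
   is possible in a C(Omega)-module, approximates f0 uniformly. So for f0
   outside N there is a point w with f0 w at positive distance from
   { g w | g in N }; the Hahn-Banach theorem gives a functional phi on X that
   vanishes on that subspace and not at f0 w, and f |-> phi (f w) is a
   character.
   The Hahn-Banach theorem is obtained from Zorn's lemma by taking a minimal
   sublinear functional: minimality forces it to be linear. *)
Require Import Defs.
From HB Require Import structures.
From mathcomp Require Import all_boot all_order all_algebra complex.
From mathcomp Require Import all_classical all_reals all_analysis.
From mathcomp Require Import ring lra.

Set Implicit Arguments.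
Unset Strict Implicit.
Unset Printing Implicit Defensive.

Import Order.TTheory GRing.Theory Num.Theory.
Import numFieldNormedType.Exports.
Import mathcomp.real_closed.complex.

Local Open Scope classical_set_scope.
Local Open Scope ring_scope.

(** * The Hahn-Banach theorem for sublinear functionals on a real vector space *)

Section hahn_banach.
Variables (R : realType) (V : lmodType R).
Implicit Types (p q g : V -> R) (G : set (V -> R)).

(** Half of positive homogeneity suffices: rescaling by the inverse of [t] gives the other half. *)
Definition sublinear p :=
  (forall x y, p (x + y) <= p x + p y) /\
  (forall t x, 0 <= t -> p (t *: x) <= t * p x).

Lemma sublinear0 p : sublinear p -> p 0 = 0.
Proof.
move=> [pD pZ]; apply/eqP; rewrite eq_le; apply/andP; split.
  by have := pZ 0 0 (lexx _); rewrite scale0r mul0r.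
by have := pD 0 0; rewrite addr0 -lerBlDl subrr.
Qed.

Lemma sublinearZ p t x : sublinear p -> 0 <= t -> p (t *: x) = t * p x.
Proof.
move=> ps; rewrite le_eqVlt => /predU1P[<-|t0].
  by rewrite scale0r mul0r sublinear0.
have [_ pZ] := ps; apply/eqP; rewrite eq_le pZ ?(ltW t0)//=.
rewrite -ler_pdivlMl// -{1}[x](scalerK (lt0r_neq0 t0)).
by rewrite pZ// invr_ge0 ltW.
Qed.

Lemma sublinear_oppr_ge p x : sublinear p -> - p (- x) <= p x.
Proof.
move=> ps; rewrite -subr_ge0 opprK.
by rewrite (le_trans _ (ps.1 x (- x)))// subrr sublinear0.
Qed.

(** Members of [G] need not be sublinear: the bound for a sum or a multiple may come from another
    member. This covers the shifts of [p], chains of functionals and distances to the points of a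
    subspace. *)
Lemma sublinear_inf G : G !=set0 ->
    (forall x, has_lbound [set g x | g in G]) ->
    (forall g h x y, G g -> G h -> exists2 k, G k & k (x + y) <= g x + h y) ->
    (forall g t x, G g -> 0 <= t -> exists2 k, G k & k (t *: x) <= t * g x) ->
  sublinear (fun x => inf [set g x | g in G]).
Proof.
move=> [g0 Gg0] lbG GD GZ.
have ne x : [set g x | g in G] !=set0 by exists (g0 x), g0.
have infG g x : G g -> inf [set g x | g in G] <= g x.
  by move=> Gg; apply: ge_inf => //; exists g.
split=> [x y|t x t0].
  rewrite -lerBlDr; apply: lb_le_inf => // _ [g Gg <-].
  rewrite lerBlDr -lerBlDl; apply: lb_le_inf => // _ [h Gh <-].
  rewrite lerBlDl; have [k Gk] := GD _ _ x y Gg Gh.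
  by apply: le_trans; exact: infG.
have tinfG g : G g -> inf [set g (t *: x) | g in G] <= t * g x.
  by move=> Gg; have [k Gk] := GZ _ _ x Gg t0; apply: le_trans; exact: infG.
move: t0; rewrite le_eqVlt => /predU1P[t0|t0].
  by have := tinfG _ Gg0; rewrite -t0 !mul0r.
rewrite -ler_pdivrMl//; apply: lb_le_inf => // _ [g Gg <-].
by rewrite ler_pdivrMl// tinfG.
Qed.

(* If [p] is minimal then [p <= sublinear_shift p x]; taking [t = 1] gives
   [p y + p x <= p (y + x)]. *)
Definition sublinear_shift p x : V -> R := fun y =>
  inf [set g y | g in [set (fun z => p (z + t *: x) - t * p x) |
                        t in [set t : R | 0 <= t]]].

Section shift.
Variables (p : V -> R) (x : V).
Hypothesis ps : sublinear p.

Let shift_lbound y : has_lbound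
  [set g y | g in [set (fun z => p (z + t *: x) - t * p x) |
                    t in [set t : R | 0 <= t]]].
Proof.
(* Subadditivity for [t *: x = (y + t *: x) - y]. *)
exists (- p (- y)) => _ [_ [t /= t0 <-] <-].
rewrite -sublinearZ// lerBrDr addrC lerBlDr.
by apply: le_trans (ps.1 _ _); rewrite addrAC subrr add0r.
Qed.

Lemma sublinear_shift_le t y : 0 <= t ->
  sublinear_shift p x y <= p (y + t *: x) - t * p x.
Proof.
move=> t0; apply: ge_inf; first exact: shift_lbound.
by exists (fun z => p (z + t *: x) - t * p x) => //; exists t.
Qed.

Lemma sublinear_shiftW y : sublinear_shift p x y <= p y.
Proof.
rewrite (le_trans (sublinear_shift_le y (lexx 0)))//.
by rewrite scale0r addr0 mul0r subr0.
Qed.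

Lemma sublinear_shiftP : sublinear (sublinear_shift p x).
Proof.
apply: sublinear_inf => [| |_ _ y z [s s0 <-] [t t0 <-]|_ c y [t t0 <-] c0].
- by exists (fun z => p (z + 0 *: x) - 0 * p x), 0 => /=.
- exact: shift_lbound.
- exists (fun z => p (z + (s + t) *: x) - (s + t) * p x).
    by exists (s + t) => //=; rewrite addr_ge0.
  rewrite mulrDl opprD addrACA lerD2r scalerDl addrACA; exact: ps.1.
- exists (fun z => p (z + (c * t) *: x) - (c * t) * p x).
    by exists (c * t) => //=; rewrite mulr_ge0.
  by rewrite mulrBr mulrA lerD2r -scalerA -scalerDr ps.2.
Qed.

End shift.

Lemma minimal_sublinear p : sublinear p -> exists q,
  [/\ sublinear q, forall x, q x <= p x & forall q', sublinear q' ->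
      (forall x, q' x <= q x) -> forall x, q x <= q' x].
Proof.
move=> ps; pose T := {q : V -> R | sublinear q /\ forall x, q x <= p x}.
pose mkT q qs qp : T := exist _ q (conj qs qp).
(* The order is reversed, so that Zorn's lemma returns a minimal functional. *)
pose below (q q' : T) := `[< forall x, sval q' x <= sval q x >].
have [||A totA|q qmin] := @ZL_preorder T (mkT p ps (fun=> lexx _)) below.
- by move=> q; apply/asboolP.
- move=> q r s /asboolP qr /asboolP rs; apply/asboolP => x.
  exact: le_trans (rs x) (qr x).
- have [->|/set0P[q0 Aq0]] := eqVneq A set0.
    by exists (mkT p ps (fun=> lexx _)).
  pose G := [set sval q | q in A].
  (* Any sublinear [q <= p] satisfies [- p (- x) <= - q (- x) <= q x]. *)
  have lbG x : has_lbound [set g x | g in G].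
    exists (- p (- x)) => _ [_ [[q [qs qp]] _ <-] <-] /=.
    by rewrite (le_trans _ (sublinear_oppr_ge x qs))// lerN2.
  have Gs : sublinear (fun x => inf [set g x | g in G]).
    apply: sublinear_inf => //; first by exists (sval q0), q0.
      move=> _ _ x y [q Aq <-] [r Ar <-].
      have [/asboolP qr|/asboolP rq] := totA _ _ Aq Ar.
        exists (sval r); first by exists r.
        by rewrite (le_trans ((svalP r).1.1 x y))// lerD2r.
      exists (sval q); first by exists q.
      by rewrite (le_trans ((svalP q).1.1 x y))// lerD2l.
    move=> _ t x [q Aq <-] t0; exists (sval q); first by exists q.
    exact: (svalP q).1.2.
  have infG (q : T) x : A q -> inf [set g x | g in G] <= sval q x.
    by move=> Aq; apply: ge_inf => //; exists (sval q) => //; exists q.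
  have Gp x : inf [set g x | g in G] <= p x.
    exact: le_trans (infG _ x Aq0) ((svalP q0).2 x).
  exists (mkT _ Gs Gp) => q Aq; apply/asboolP => x; exact: infG.
exists (sval q); split; [exact: (svalP q).1|exact: (svalP q).2|].
move=> q' q's q'q; have q'p x : q' x <= p x.
  exact: le_trans (q'q x) ((svalP q).2 x).
by have /(_ (asboolT q'q))/asboolP := qmin (mkT q' q's q'p).
Qed.

(** A minimal sublinear functional is linear. Minimality is imposed below the shift of [p] along
    [x0] instead of below [p], because that shift is at most [- p x0] at [- x0], which forces
    [f x0 = p x0]. *)
Lemma hahn_banach p x0 : sublinear p -> exists f : V -> R,
  [/\ {morph f : x y / x + y}, forall t x, f (t *: x) = t * f x,
      forall x, f x <= p x & f x0 = p x0].
Proof.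
move=> ps.
have [f [fs fp fmin]] := minimal_sublinear (sublinear_shiftP x0 ps).
have fD : {morph f : x y / x + y}.
  move=> x y; apply/eqP; rewrite eq_le fs.1 /= addrC -lerBrDr.
  apply: le_trans (fmin _ (sublinear_shiftP x fs) (sublinear_shiftW x fs) y) _.
  rewrite (le_trans (sublinear_shift_le x fs y ler01))//.
  by rewrite scale1r mul1r [y + x]addrC.
have fN x : f (- x) = - f x.
  by apply/eqP; rewrite -addr_eq0 -fD addNr (sublinear0 fs).
have fZ t x : f (t *: x) = t * f x.
  have [t0|t0] := leP 0 t; first exact: sublinearZ.
  by rewrite -[t]opprK scaleNr fN sublinearZ ?mulNr// oppr_ge0 ltW.
have fp' x : f x <= p x by rewrite (le_trans (fp x))// sublinear_shiftW.
exists f; split=> //; apply/eqP; rewrite eq_le fp' /= -lerN2 -fN.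
rewrite (le_trans (fp _))// (le_trans (sublinear_shift_le x0 ps _ ler01))//.
by rewrite scale1r addNr (sublinear0 ps) mul1r sub0r.
Qed.

End hahn_banach.

(** * Restriction of scalars to the reals, on a type synonym so that the two scalings do not
    clash *)

Definition realified (R : realType) (V : lmodType R[i]) : Type := V.

Section realified.
Variables (R : realType) (V : lmodType R[i]).

HB.instance Definition _ := GRing.Zmodule.copy (realified V) V.

Let rscale (t : R) (x : realified V) : realified V := t%:C%C *: (x : V).

Fact realified_scalerA s t x : rscale s (rscale t x) = rscale (s * t) x.
Proof. by rewrite /rscale scalerA rmorphM. Qed.
Fact realified_scale1r : left_id 1 rscale.
Proof. by move=> x; rewrite /rscale scale1r. Qed.
Fact realified_scalerDr : right_distributive rscale +%R.
Proof. by move=> t x y; rewrite /rscale scalerDr. Qed.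
Fact realified_scalerDl x : {morph rscale^~ x : s t / s + t}.
Proof. by move=> s t; rewrite /rscale rmorphD scalerDl. Qed.

HB.instance Definition _ := GRing.Zmodule_isLmodule.Build R (realified V)
  realified_scalerA realified_scale1r realified_scalerDr realified_scalerDl.

End realified.

(** * Separation of a point from a complex subspace by a bounded functional *)

Section complex_separation.
Variables (R : realType) (X : normedModType R[i]) (Y : set X).
Hypotheses (Y0 : Y 0) (YD : forall x y, Y x -> Y y -> Y (x + y))
  (YZ : forall (k : R[i]) x, Y x -> Y (k *: x)).

(** [dist_to] is the quotient seminorm modulo [Y], in the form that [sublinear_inf] expects. *)
Let dists := [set (fun x : realified X => Re `|(x : X) - y|) | y in Y].
Let dist_to (x : realified X) : R := inf [set g x | g in dists].

Let dist_lbound x : lbound [set g x | g in dists] 0.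
Proof. by move=> _ [_ [y Yy <-] <-]; exact: lecR_Re (normr_ge0 _). Qed.

Let dist_ubW (x : realified X) y : Y y -> dist_to x <= Re `|(x : X) - y|.
Proof.
move=> Yy; apply: ge_inf; first by exists 0; exact: dist_lbound.
by exists (fun x : realified X => Re `|(x : X) - y|) => //; exists y.
Qed.

Let dist_sublinear : sublinear dist_to.
Proof.
apply: sublinear_inf => [|x|_ _ x z [y Yy <-] [y' Yy' <-]|_ t x [y Yy <-] t0].
- by exists (fun x : realified X => Re `|(x : X) - 0|), 0.
- by exists 0; exact: dist_lbound.
- exists (fun x : realified X => Re `|(x : X) - (y + y')|).
    by exists (y + y') => //; exact: YD.
  rewrite -raddfD; apply: lecR_Re.
  by rewrite opprD addrACA ler_normD.
- exists (fun x : realified X => Re `|(x : X) - t%:C%C *: y|).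
    by exists (t%:C%C *: y) => //; exact: YZ.
  rewrite -lecR rmorphM /= !normc_reE.
  have t0' : 0 <= t%:C%C :> R[i] by rewrite lecR.
  by rewrite -[X in X - _]/(t%:C%C *: (x : X)) -scalerBr normrZ (ger0_norm t0').
Qed.

(** Hahn-Banach for the distance to [Y] gives a real functional that is positive at [x0] and
    nonpositive on [Y], hence zero on [Y], which is stable under negation. *)
Lemma separating_functional (x0 : X) (e : R[i]) : 0 < e ->
    (forall y, Y y -> e <= `|x0 - y|) ->
  exists phi : X -> R[i],
    [/\ {morph phi : x y / x + y}, forall k x, phi (k *: x) = k * phi x,
        forall x, Y x -> phi x = 0, phi x0 != 0
      & forall x, `|phi x| <= 2 * `|x|].
Proof.
move=> e0 x0Y.
have [f [fD fZ fp fx0]] := hahn_banach (x0 : realified X) dist_sublinear.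
have fN x : f (- x) = - f x by rewrite -scaleN1r fZ mulN1r.
have fY x : Y x -> f x = 0.
  move=> Yx; have fle0 y : Y y -> f y <= 0.
    move=> Yy; rewrite (le_trans (fp y))// (le_trans (dist_ubW _ Yy))//.
    by rewrite subrr normr0.
  apply/eqP; rewrite eq_le fle0//= -oppr_le0 -fN fle0//.
  by rewrite -scaleN1r; exact: YZ.
have fx0_gt0 : 0 < f x0.
  apply: (@lt_le_trans _ _ (Re e)).
    by rewrite -ltcR RRe_real ?gtr0_real.
  rewrite fx0; apply: lb_le_inf.
    exists (Re `|x0 - 0|), (fun x : realified X => Re `|(x : X) - 0|) => //.
    by exists 0.
  by move=> _ [_ [y Yy <-] <-]; apply: lecR_Re; exact: x0Y.
have fle x : `|f x|%:C%C <= `|x|.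
  have fle1 (y : X) : f y <= Re `|y|.
    by rewrite -[y in leRHS]subr0 (le_trans (fp y))// dist_ubW.
  rewrite -normc_reE lecR ler_norml fle1 andbT lerNl -fN.
  by rewrite (le_trans (fle1 _))// normrN.
(* The usual complexification: the complex-linear functional with real part [f]. *)
pose phi x : R[i] := Complex (f x) (- f ('i%C *: x)).
exists phi; split.
- by move=> x y; rewrite /phi scalerDr !fD opprD.
- move=> [a b] x; rewrite /phi.
  have zE (c d : R) (y : X) :
      f (Complex c d *: y) = c * f y + d * f ('i%C *: y).
    rewrite [Complex c d]complexE scalerDl -scalerA scalerA mulrC -scalerA.
    by rewrite fD !fZ.
  rewrite scalerA.
  have -> : 'i%C * Complex a b = Complex (- b) a.
    by apply/eqP; rewrite eq_complex /=; apply/andP; split; apply/eqP; ring.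
  rewrite (zE a b x) (zE (- b) a x); apply/eqP; rewrite eq_complex /=.
  by apply/andP; split; apply/eqP; ring.
- by move=> x Yx; rewrite /phi !fY ?oppr0//; exact: YZ.
- by rewrite /phi eq_complex /= negb_and gt_eqF.
- move=> x; rewrite (le_trans (normc_le_ReIm _))//= normrN rmorphD /=.
  rewrite mulrDl mul1r lerD// (le_trans (fle _))// normrZ.
  by rewrite normc_def /= expr0n /= expr1n add0r sqrtr1 mul1r.
Qed.

End complex_separation.

(** * Localization of closed submodules at points of [Omega] *)

Section localization.
Variables (R : realType) (Omega : topologicalType).
Variables (cOmega : compact [set: Omega]) (X : completeNormedModType R[i]).
Local Notation CC := (contfun cOmega R[i]).
Local Notation CX := (contfun cOmega X).
Local Notation M := (contfun_banachModule cOmega X).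

(** The weight is the positive part of [d - |u w|]: where it is nonzero, [|u w| < d]; elsewhere both
    sides of the middle bound vanish. *)
Lemma bump_function (d : R[i]) (u : CX) : 0 < d -> exists s : CC, forall w,
  [/\ 0 <= s w, s w * `|u w| <= s w * d & `|u w| < d -> 0 < s w].
Proof.
move=> d0; pose b w : R := Num.max 0 (Re d - Re `|u w|).
have dE : d = (Re d)%:C%C by rewrite RRe_real ?gtr0_real.
have bc : continuous (fun w => (b w)%:C%C : R[i]).
  move=> w; apply/cvgrPdist_lt => e e0.
  have /cvgrPdist_lt /(_ _ e0) := cts_fun (s := u) w.
  apply: filterS => v; apply: le_lt_trans.
  apply: le_trans (ler_dist_dist (u w) (u v)).
  rewrite -(normc_reE (u w)) -(normc_reE (u v)) -!rmorphB /=.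
  rewrite !normc_def /= !expr0n /= !addr0 !sqrtr_sqr lecR /b.
  have := ler_norm (Re `|u v| - Re `|u w|); rewrite distrC.
  have := ler_norm (Re `|u w| - Re `|u v|).
  by rewrite ler_norml !maxEle; do 2!case: ifPn; lra.
pose s : CC := mkcts bc; exists s => w; have -> : s w = (b w)%:C%C by [].
rewrite -normc_reE dE -!rmorphM !lecR !ltcR /b maxEle.
case: ifPn => h; split=> //; first by rewrite ler_wpM2l// -subr_ge0.
- by move=> h'; move: h; lra.
- by rewrite !mul0r.
- by move=> h'; move: h; lra.
Qed.

(* [(s, q)] stands for the quotient [q / s], which is [d]-close to [f0] off the
   zeros of [s]; such pairs can be added without dividing. *)
Definition approximant (N : set M) (f0 : CX) (d : R[i]) (sq : CC * CX) :=
  N sq.2 /\ forall w, 0 <= sq.1 w /\ `|sq.1 w *: f0 w - sq.2 w| <= sq.1 w * d.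

Lemma approximantD (N : set M) f0 d s q t r : submodule N ->
    approximant N f0 d (s, q) -> approximant N f0 d (t, r) ->
  approximant N f0 d (s + t, q + r).
Proof.
move=> [_ ND _ _] [/= Nq sq] [/= Nr tr]; split; first exact: ND.
move=> w; have [s0 sd] := sq w; have [t0 td] := tr w => /=.
rewrite -[(s + t) w]/(s w + t w) -[(q + r) w]/(q w + r w).
split; first exact: addr_ge0.
rewrite scalerDl opprD addrACA (le_trans (ler_normD _ _))// mulrDl.
exact: lerD.
Qed.

(* Compactness: otherwise the zero sets of the weights, which are stable under
   intersection because the weights are nonnegative, have a common point. *)
Lemma positive_approximant (N : set M) (f0 : CX) (d : R[i]) :
    submodule N -> 0 < d ->
    (forall w, exists2 g : CX, N g & `|f0 w - g w| < d) ->
  exists2 sq, approximant N f0 d sq & forall w, 0 < sq.1 w.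
Proof.
move=> sN d0 close; apply: contrapT => noapprox.
have [N0 ND _ NA] := sN.
pose Z (sq : CC * CX) := [set w | sq.1 w = 0].
pose F := filter_from (approximant N f0 d) Z.
have FF : ProperFilter F.
  apply: filter_from_proper; first apply: filter_from_filter.
  - exists (0, 0); split=> // w /=; split=> //.
    rewrite -[X in `|X|]/((0 : R[i]) *: f0 w - 0) scale0r subrr normr0.
    by rewrite [leRHS]mul0r.
  - move=> [s q] [t r] sq tr; exists (s + t, q + r); first exact: approximantD.
    move=> w /= /eqP; rewrite -[(s + t) w]/(s w + t w).
    have [s0 _] := sq.2 w; have [t0 _] := tr.2 w.
    by rewrite paddr_eq0// => /andP[/eqP ? /eqP ?].
  (* An empty zero set would make the weight positive everywhere, against [noapprox]. *)
  - move=> sq Asq; apply: contrapT => nz; apply: noapprox; exists sq => // w.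
    rewrite lt_neqAle (Asq.2 w).1 andbT eq_sym; apply/eqP => sw.
    by apply: nz; exists w.
have [w [_ clw]] := cOmega FF filterT.
have [g Ng gd] := close w.
(* The bump of [f0 - g] is positive near the cluster point [w], so its zero set cannot cluster
   there. *)
have [s sP] := bump_function (f0 - g) d0.
have As : approximant N f0 d (s, contfun_act s g).
  split=> [|v /=]; first exact: NA.
  have [s0 sd _] := sP v; split=> //.
  by rewrite -[contfun_act s g v]/(s v *: g v) -scalerBr normrZ ger0_norm.
have [_ _ /(_ gd) sw] := sP w.
have snz : nbhs w [set v | s v != 0].
  have /cvgrPdist_lt /(_ _ sw) := cts_fun (s := s) w.
  apply: filterS => v swv; apply/eqP => sv.
  by move: swv; rewrite sv subr0 gtr0_norm// ltxx.
have [v [/= sv0]] := clw _ _ (ex_intro2 _ _ _ As (@subset_refl _ (Z _))) snz.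
by move=> /eqP.
Qed.

(** Otherwise dividing a positive approximant by its weight gives an element of [N] as near to [f0]
    as desired, and [N] is closed. *)
Lemma submodule_localization (N : set M) (f0 : CX) :
    submodule N -> closed N -> ~ N f0 ->
  exists w, exists2 e : R[i], 0 < e & forall g : CX, N g -> e <= `|f0 w - g w|.
Proof.
move=> sN cN Nf0; apply: contrapT => noloc; apply: Nf0; apply: cN.
move=> B /nbhs_ballP[e /= e0 eB].
(* The supremum norm gives only a weak inequality [<= d]; halving [e] makes it strict. *)
have d0 : 0 < e / 2 by rewrite divr_gt0.
set d := e / 2 in d0.
have close w : exists2 g : CX, N g & `|f0 w - g w| < d.
  apply: contrapT => far; apply: noloc; exists w, d => // g Ng.
  rewrite real_leNgt ?normr_real ?gtr0_real//; apply/negP => gd.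
  by apply: far; exists g.
have [[s q] [/= Nq sq] s_gt0] := positive_approximant sN d0 close.
(* The weight vanishes nowhere, so its inverse belongs to the algebra and the quotient stays in
   [N]. *)
have sVc : continuous (fun w => (s w)^-1).
  by move=> w; apply: cvgV; [rewrite gt_eqF | exact: cts_fun].
exists (contfun_act (mkcts sVc : CC) q); split.
  by case: sN => _ _ _; apply.
apply: eB; rewrite -ball_normE /=.
apply: (@le_lt_trans _ _ d); last by rewrite ltr_pdivrMr// ltr_pMr// ltr1n.
apply: supnorm_le => [|w]; first exact: ltW.
have [_ sqd] := sq w.
rewrite -[X in `|X|]/(f0 w - (s w)^-1 *: q w).
have -> : f0 w - (s w)^-1 *: q w = (s w)^-1 *: (s w *: f0 w - q w).
  by rewrite scalerBr scalerA mulVf ?gt_eqF// scale1r.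
by rewrite normrZ gtr0_norm ?invr_gt0// ler_pdivrMl.
Qed.

End localization.

(** * The character at a point and its kernel *)

Theorem proposition1p6 (R : realType) (Omega : topologicalType)
  (cOmega : compact [set: Omega]) (hOmega : hausdorff_space Omega)
  (X : completeNormedModType R[i]) :
  nice (contfun_banachModule cOmega X).
Proof.
move=> N sN cN NT.
have [f0 Nf0] : exists f0, ~ N f0.
  apply: contrapT => allN; move/eqP: NT; apply; apply/seteqP; split=> // f _.
  by apply: contrapT => Nf; apply: allN; exists f.
have [w [e e0 he]] := submodule_localization sN cN Nf0.
have [N0 ND NZ NA] := sN.
pose ev (f : contfun cOmega X) : X := f w.
have Y0 : (ev @` N) 0 by exists 0.
have YD x y : (ev @` N) x -> (ev @` N) y -> (ev @` N) (x + y).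
  by move=> [f Nf <-] [g Ng <-]; exists (f + g) => //; exact: ND.
have YZ (k : R[i]) x : (ev @` N) x -> (ev @` N) (k *: x).
  by move=> [f Nf <-]; exists (k *: f) => //; exact: NZ.
have far y : (ev @` N) y -> e <= `|ev f0 - y| by move=> [g Ng <-]; exact: he.
have [phi [phiD phiZ phiY phif0 phi_le]] :=
  separating_functional Y0 YD YZ e0 far.
have phi0 : phi 0 = 0 by rewrite -(scale0r 0) phiZ mul0r.
(* This kernel is a submodule because [a] acts on values at [w] as the scalar [a w]. *)
exists [set f | phi (ev f) = 0]; split.
- split=> [//|f g /= f0' g0|k f /= f0'|a f /= f0'].
  + by change (phi (ev f + ev g) = 0); rewrite phiD f0' g0 addr0.
  + by change (phi (k *: ev f) = 0); rewrite phiZ f0' mulr0.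
  + change (phi ((a : contfun cOmega R[i]) w *: ev f) = 0).
    by rewrite phiZ f0' mulr0.
- move=> f fcl; apply/eqP/negPn/negP => phif /=.
  (* Half of the value matches the factor 2 in [phi_le]: no [g] in the kernel is this near to
     [f]. *)
  have c0 : 0 < `|phi (ev f)| / 2 by rewrite divr_gt0 ?normr_gt0.
  have [g [/= g0 fg]] := fcl _ (nbhsx_ballx f _ c0).
  move: fg; rewrite -ball_normE /= ltr_pdivlMr// mulrC => fg.
  have : `|phi (ev f)| <= 2 * `|f - g|.
    have -> : phi (ev f) = phi (ev f - ev g).
      by rewrite phiD -scaleN1r phiZ [phi (ev g)]g0 mulr0 addr0.
    rewrite (le_trans (phi_le _))// ler_wpM2l//.
    exact: (supnorm_ge (f - g : contfun cOmega X)).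
  by move/(lt_le_trans fg); rewrite ltxx.
(* The class of [f0] spans the quotient, since [phi (ev f0)] is nonzero. *)
- exists f0 => [|f]; first by move=> /= phi_eq0; rewrite phi_eq0 eqxx in phif0.
  exists (phi (ev f) / phi (ev f0)) => /=.
  change (phi (ev f - (phi (ev f) / phi (ev f0)) *: ev f0) = 0).
  by rewrite phiD -scaleN1r !phiZ divfK// mulN1r subrr.
- by move=> f Nf /=; apply: phiY; exists f.
Qed.
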